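(* For all positive integers $m,n$, $$\sum_{k=1}^n \binom{2n}{n-k} k^{1+2m} = \frac{1}{2}\binom{2n}{n} \sum_{\ell=0}^m (-1)^\ell\, \langle n\rangle_\ell\, \langle n\rangle_{\ell+1}\, \sigma_{m,\ell}(n).$$
   Context: Falling factorial: $\langle x\rangle_0=1$ and $\langle x\rangle_j = x(x-1)\cdots(x-j+1)$ for positive integers $j$. For nonnegative integers $\ell\le m$ and an indeterminate $y$, $\sigma_{m,\ell}(y)$ denotes the coefficient of $T^{m-\ell}$ in the formal power series $\prod_{j=0}^{\ell} \frac{1}{1-T(y-j)^2}$; equivalently $\sigma_{m,\ell}(y)=\sum_{0\le k_1\le\cdots\le k_{m-\ell}\le \ell}\prod_{i=1}^{m-\ell}(y-k_i)^2$. *)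

(* Defs.v *)
From mathcomp Require Import all_boot all_algebra.
Set Implicit Arguments.
Unset Strict Implicit.
Unset Printing Implicit Defensive.
Import GRing.Theory.
Local Open Scope ring_scope.

(* The formal power series with coefficients c_0, c_1, ... in T is represented
   by its coefficient sequence. *)
Definition fps (R : Type) : Type := nat -> R.

Definition fps_one (R : comNzRingType) : fps R := fun n => (n == 0%N)%:R.

Definition fps_mul (R : comNzRingType) (f g : fps R) : fps R :=
  fun n => \sum_(i < n.+1) f i * g (n - i)%N.

(* 1 / (1 - a T) *)
Definition fps_geom (R : comNzRingType) (a : R) : fps R := fun n => a ^+ n.

Lemma fps_geomP (R : comNzRingType) (a : R) :
  fps_mul (fun i => (1 - a *: 'X : {poly R})`_i) (fps_geom a) =1 fps_one R.
Proof.
move=> n; rewrite /fps_mul /fps_geom /fps_one big_ord_recl subn0.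
rewrite coefB coef1 coefZ coefX mulr0 subr0 mul1r.
case: n => [|n]; first by rewrite big_ord0 addr0.
rewrite big_ord_recl coefB coef1 coefZ coefX /= mulr1 sub0r mulNr subn1 /=.
rewrite -exprS big1 ?addr0 ?subrr // => i _.
by rewrite coefB coef1 coefZ coefX /= mulr0 subr0 mul0r.
Qed.

(* The indeterminate y is 'X; the notion is only meaningful for l <= m. *)
Definition sigma (R : comNzRingType) (m l : nat) : {poly R} :=
  (\big[@fps_mul {poly R} / fps_one {poly R}]_(j < l.+1)
     fps_geom (('X - j%:R) ^+ 2)) (m - l)%N.

(* Main.v *)
Require Import Defs.
From mathcomp Require Import all_boot all_algebra.
From mathcomp Require Import ring zify.
Set Implicit Arguments.
Unset Strict Implicit.
Unset Printing Implicit Defensive.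
Import GRing.Theory.
Local Open Scope ring_scope.

(** Newton interpolation at the nodes [(n - j)^2] writes [k^(2m)] as
    [\sum_l sigma_{m,l}(n) \prod_(i < l) (k^2 - (n - i)^2)]. Each product is
    [(-1)^l <n-k>_l <n+k>_l], and these falling factorials are absorbed by the
    binomial coefficient, which reduces the sum over [k] for a given [l] to
    [2 \sum_k k 'C(2N, N - k) = N 'C(2N, N)] with [N = n - l]. The latter sum
    telescopes. *)

(** Coefficient [d] is the complete homogeneous symmetric polynomial of degree [d] in
    [a 0, ..., a (l - 1)]; [sigma] is the case of nodes [('X - j)^2]. *)
Definition complete_symm (R : comNzRingType) (a : nat -> R) (l : nat) : fps R :=
  \big[@fps_mul R / fps_one R]_(j < l) fps_geom (a j).

Lemma complete_symm0 (R : comNzRingType) (a : nat -> R) d :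
  complete_symm a 0 d = (d == 0%N)%:R.
Proof. by rewrite /complete_symm big_ord0. Qed.

Lemma complete_symmS0 (R : comNzRingType) (a : nat -> R) l :
  complete_symm a l 0 = 1.
Proof.
elim: l a => [|l IHl] a; first by rewrite complete_symm0.
rewrite /complete_symm big_ord_recl /fps_mul big_ord1 /fps_geom mul1r.
exact: (IHl (fun j => a j.+1)).
Qed.

Lemma complete_symmSS (R : comNzRingType) (a : nat -> R) l d :
  complete_symm a l.+1 d.+1 =
  a 0%N * complete_symm a l.+1 d + complete_symm (fun j => a j.+1) l d.+1.
Proof.
rewrite /complete_symm !big_ord_recl /fps_mul big_ord_recl /=.
rewrite {1}/fps_geom mul1r addrC; congr (_ + _).
rewrite big_distrr /=; apply: eq_bigr => i _.
by rewrite /fps_geom exprS mulrA.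
Qed.

(** The divided differences of a power are complete symmetric polynomials. The induction keeps [a]
    general, since it also needs the shifted nodes [b]. *)
Lemma newton_expr (R : comNzRingType) (a : nat -> R) (x : R) m :
  x ^+ m = \sum_(l < m.+1)
    complete_symm a l.+1 (m - l)%N * \prod_(j < l) (x - a j).
Proof.
elim: m a => [|m IHm] a.
  by rewrite big_ord1 complete_symmS0 big_ord0 mulr1.
pose b j := a j.+1.
have xS : x ^+ m.+1 = a 0%N * x ^+ m + (x - a 0%N) * x ^+ m.
  by rewrite exprS; ring.
(* Only the copy multiplied by [x - a 0] is expanded at [b]: that factor completes each shifted
   product to one over [a]. *)
rewrite xS {1}(IHm a) (IHm b) !big_distrr /=.
rewrite [in RHS]big_ord_recl [\sum_(i < m.+1) a _ * _]big_ord_recl.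
rewrite !big_ord0 /= subn0 complete_symmSS.
rewrite complete_symm0 addr0 !mulr1 -addrA; congr (_ + _).
rewrite [in RHS]big_ord_recr [\sum_(i < m.+1) (x - _) * _]big_ord_recr /=.
rewrite addrA -big_split /= /bump !add1n !subnn !complete_symmS0 !mul1r.
congr (_ + _); last by rewrite big_ord_recl.
apply: eq_bigr => i _; rewrite add1n subSS.
have -> : (m - i = (m - i.+1).+1)%N by have := ltn_ord i; lia.
by rewrite (complete_symmSS a) big_ord_recl /= -/b; ring.
Qed.

(** Telescopes: [2 (n - j) 'C(2n, j) = (j + 1) 'C(2n, j + 1) - j 'C(2n, j)]. *)
Lemma sum_subn_bin (n m : nat) : (m <= n)%N ->
  (2 * \sum_(j < m) (n - j) * 'C(2 * n, j) = m * 'C(2 * n, m))%N.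
Proof.
elim: m => [|m IHm] le_mn; first by rewrite big_ord0.
rewrite big_ord_recr /= mulnDr IHm 1?ltnW // mul_bin_left mulnA -mulnDl.
by congr (_ * _)%N; lia.
Qed.

Lemma mul_bin_double (n j : nat) :
  ('C(2 * n.+1, j.+1) * j.+1 * (2 * n.+1 - j.+1)
   = (2 * n.+1) * (2 * n).+1 * 'C(2 * n, j))%N.
Proof.
have -> : (2 * n.+1 = (2 * n).+2)%N by lia.
rewrite (mulnC 'C(_, _)) -mul_bin_diag /= subSS.
by rewrite -!mulnA (mulnC 'C(_, _)) -mul_bin_down.
Qed.

(** Induction on [l]: the term [j = 0] vanishes, and in the others [mul_bin_double] absorbs the
    leading factor of each falling factorial, lowering [n] and [j] by one. *)
Lemma sum_bin_ffact (n l : nat) :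
  (2 * \sum_(j < n) 'C(2 * n, j) * (n - j) * (j ^_ l * (2 * n - j) ^_ l)
   = 'C(2 * n, n) * (n ^_ l * n ^_ l.+1))%N.
Proof.
elim: l n => [|l IHl] n.
  rewrite ffactn0 ffactn1 mul1n [RHS]mulnC -sum_subn_bin //; congr (_ * _)%N.
  by apply: eq_bigr => j _; rewrite !ffactn0 !muln1 mulnC.
case: n => [|n]; first by rewrite big_ord0 !ffact0n !muln0.
rewrite big_ord_recl /= ffact0n mul0n muln0 add0n.
transitivity ((2 * n.+1) * (2 * n).+1 * (2 * \sum_(j < n)
    'C(2 * n, j) * (n - j) * (j ^_ l * (2 * n - j) ^_ l)))%N.
  rewrite mulnCA; congr (_ * _)%N; rewrite big_distrr /=.
  apply: eq_bigr => j _; rewrite /bump add1n subSS !ffactSS.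
  have -> : (2 * n.+1 - j.+1 = (2 * n - j).+1)%N by have := ltn_ord j; lia.
  rewrite ffactSS.
  have := mul_bin_double n j.
  have -> : (2 * n.+1 - j.+1 = (2 * n - j).+1)%N by have := ltn_ord j; lia.
  move=> E; rewrite [RHS]mulnA [X in _ = (X * _)%N]mulnA -E; ring.
(* The same absorption, read backwards at [j = n], restores the central binomial coefficient. *)
rewrite IHl mulnA -mul_bin_double !ffactSS.
have -> : (2 * n.+1 - n.+1 = n.+1)%N by lia.
ring.
Qed.

Lemma natr_ffactS (R : pzRingType) (n l : nat) :
  (n ^_ l.+1)%:R = (n ^_ l)%:R * (n%:R - l%:R) :> R.
Proof.
rewrite ffactnSr natrM; have [le_ln|lt_nl] := leqP l n; first by rewrite natrB.
by rewrite ffact_small // !mul0r.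
Qed.

(** Each factor is [- (j - i) (2n - j - i)]. *)
Lemma prod_sqr_sub (R : comPzRingType) (n j l : nat) : (j <= n)%N ->
  \prod_(i < l) ((n - j)%:R ^+ 2 - (n%:R - i%:R) ^+ 2)
  = (-1) ^+ l * (j ^_ l * (2 * n - j) ^_ l)%:R :> R.
Proof.
move=> le_jn; elim: l => [|l IHl]; first by rewrite big_ord0 mulr1.
rewrite big_ord_recr /= IHl 2!natrM !natr_ffactS [_ ^+ l.+1]exprS.
rewrite (natrB _ le_jn) natrB; last by lia.
by rewrite natrM; ring.
Qed.

Lemma exprn_sigma (R : comNzRingType) (m n j : nat) : (j <= n)%N ->
  (n - j)%:R ^+ (2 * m) = \sum_(l < m.+1) (sigma R m l).[n%:R] *
    ((-1) ^+ l * (j ^_ l * (2 * n - j) ^_ l)%:R) :> R.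
Proof.
move=> le_jn.
(* The expansion is made over [{poly R}] at a constant polynomial, so that its coefficients are
   literally [sigma], and then evaluated at [n]. *)
have := newton_expr (fun i => ('X - i%:R) ^+ 2 : {poly R})
  ((n - j)%:R ^+ 2)%:P m.
move/(congr1 (horner^~ n%:R)); rewrite -rmorphXn hornerC -exprM => ->.
rewrite horner_sum; apply: eq_bigr => l _.
rewrite hornerM; congr (_ * _); rewrite -prod_sqr_sub // horner_prod.
by apply: eq_bigr => i _; rewrite !hornerE -polyC_natr hornerC.
Qed.

Theorem theorem4 (m n : nat) (m_gt0 : (0 < m)%N) (n_gt0 : (0 < n)%N) :
  \sum_(1 <= k < n.+1) 'C(2 * n, n - k)%:R * k%:R ^+ (1 + 2 * m)
  = 1 / 2 * 'C(2 * n, n)%:R *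
    \sum_(0 <= l < m.+1)
      (-1) ^+ l * (n ^_ l)%:R * (n ^_ l.+1)%:R * (sigma rat m l).[n%:R] :> rat.
Proof.
(* The sum now runs over [j = n - k], from [0] to [n - 1]. *)
rewrite big_add1 !big_mkord (reindex_inj rev_ord_inj) /=.
transitivity (\sum_(j < n) \sum_(l < m.+1) (-1) ^+ l * (sigma rat m l).[n%:R] *
    ('C(2 * n, j) * (n - j) * (j ^_ l * (2 * n - j) ^_ l))%:R).
  apply: eq_bigr => j _; rewrite subnSK // subKn; last exact: ltnW.
  rewrite exprD expr1 exprn_sigma 1?ltnW // !big_distrr /=.
  by apply: eq_bigr => l _; rewrite !natrM; ring.
rewrite exchange_big big_distrr /=; apply: eq_bigr => l _.
rewrite -big_distrr -natr_sum.
have /(congr1 (fun k => k%:R : rat)) := sum_bin_ffact n l.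
rewrite 3!natrM => E.
have -> : 1 / 2 * 'C(2 * n, n)%:R * ((-1) ^+ l * (n ^_ l)%:R * (n ^_ l.+1)%:R
    * (sigma rat m l).[n%:R]) = (-1) ^+ l * (sigma rat m l).[n%:R] *
    (1 / 2 * ('C(2 * n, n)%:R * ((n ^_ l)%:R * (n ^_ l.+1)%:R))) by ring.
by rewrite -E /=; field.
Qed.
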